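(* Let $k\in\mathbb N$, $k\ge2$, and let $E$ be a symmetric space with the Fatou property. If $E^d$ is compactly fully $k$-rotund and strictly $K$-monotone, then $E$ is decreasing uniformly $K$-monotone.
   Context: Let $I=[0,\alpha)$, $\alpha=1$ or $\alpha=\infty$, with Lebesgue measure $\mu$, and $L^0$ the set of (classes of) extended real valued measurable functions on $I$. A Banach function space $(E,\|\cdot\|_E)$ is a Banach lattice that is a sublattice of $L^0$ such that (1) if $x\in L^0$, $y\in E$, $|x|\le|y|$ a.e., then $x\in E$ and $\|x\|_E\le\|y\|_E$; (2) there is a strictly positive $x\in E$. $E^+=\{x\in E:x\ge0\}$; $S_E$ is the unit sphere. Fatou property: if $(x_n)\subset E^+$, $\sup_n\|x_n\|_E<\infty$ and $x_n\uparrow x\in L^0$, then $x\in E$ and $\|x_n\|_E\uparrow\|x\|_E$. For $x\in L^0$: $d_x(\lambda)=\mu\{s\in I:|x(s)|>\lambda\}$, $x^*(t)=\inf\{\lambda>0:d_x(\lambda)\le t\}$, $x^{**}(t)=\frac1t\int_0^t x^*(s)\,ds$. A symmetric space is a Banach function space $E$ such that $x\in L^0$, $y\in E$, $d_x=d_y$ imply $x\in E$ and $\|x\|_E=\|y\|_E$. $x\prec y$ means $x^{**}(t)\le y^{**}(t)$ for all $t>0$. $E^d=\{x^*:x\in E\}$ (the cone of nonnegative decreasing elements). A property holds on $E^d$ if its definition holds when only elements of $E^d$ are considered. $E^d$ is compactly fully $k$-rotund if every sequence $(x_n)\subset S_E\cap E^d$ such that $\|\sum_{i=1}^k x_{n,i}\|_E\to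 k$ as $n\to\infty$ for any $k$ subsequences $(x_{n,1})_n,\dots,(x_{n,k})_n$ of $(x_n)$ forms a relatively compact set. $E$ is strictly $K$-monotone if $x,y\in E$, $x\prec y$, $x^*\ne y^*$ imply $\|x\|_E<\|y\|_E$ (since this depends only on $x^*,y^*$, it is the same condition on $E^d$ as on $E$). $E$ is decreasing uniformly $K$-monotone if for any $(x_n),(y_n)\subset E$ with $x_{n+1}\prec x_n\prec y_n$ for all $n\in\mathbb N$ and $\lim_n\|x_n\|_E=\lim_n\|y_n\|_E<\infty$ one has $\|x_n^*-y_n^*\|_E\to0$. *)

(* Defs.v *)
From HB Require Import structures.
From mathcomp Require Import all_boot all_order all_algebra.
From mathcomp Require Import all_classical all_reals all_analysis.
From mathcomp Require Import measurable_realfun.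

Set Implicit Arguments.
Unset Strict Implicit.
Unset Printing Implicit Defensive.

Import Order.TTheory GRing.Theory Num.Theory.
Import numFieldNormedType.Exports.

Local Open Scope classical_set_scope.
Local Open Scope ring_scope.

Section L0.
Context {R : realType}.
Implicit Types (alpha : \bar R) (I : set R) (f g : R -> \bar R).

Definition base_interval alpha : set R := [set t | 0 <= t /\ (t%:E < alpha)%E].

(* An element of L^0(I) is a total function, measurable on I, of which only
   the values on I matter; equality in L^0(I) is equality a.e. on I.
   Measurability is with respect to the Borel sets, which loses no class: every
   Lebesgue measurable function is a.e. equal to a Borel one. *)
Definition eq_L0 I f g : Prop := f = g %[ae (@lebesgue_measure R) in I].

Definition ae_on I (P : R -> Prop) : Prop :=
  {ae (@lebesgue_measure R), forall t, I t -> P t}.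

Definition distr I f (l : R) : \bar R :=
  lebesgue_measure (I `&` [set s | (l%:E < `|f s|)%E]).

(* The infimum of the empty set is +oo. *)
Definition rearr I f (t : R) : \bar R :=
  ereal_inf [set l%:E | l in [set l : R | 0 < l /\ (distr I f l <= t%:E)%E]].

Definition maximal_rearr I f (t : R) : \bar R :=
  ((t^-1)%:E * \int[lebesgue_measure]_(s in `[0%R, t]) rearr I f s)%E.

Definition submaj I f g : Prop :=
  forall t : R, 0 < t -> (maximal_rearr I f t <= maximal_rearr I g t)%E.

End L0.

(* A Banach function space is a Banach space E with an injective linear map into
   L^0(I), given by the choice j of a representative of each element of E.
   "f belongs to E" reads "f is a.e. equal to j x for some x in E".
   That the elements of E are finite a.e., which gives a meaning to their
   pointwise sum, is implicit in E being a vector space inside L^0(I): if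
   |f| = +oo on A for some f in E, then +oo * 1_A is in E and equals its double,
   so it is 0. *)
Record banach_function_space (R : realType) (I : set R)
    (E : completeNormedModType R) (j : E -> R -> \bar R) : Prop := {
  bfs_measurable : forall x, measurable_fun I (j x);
  bfs_finite : forall x, ae_on I (fun t => j x t \is a fin_num);
  bfs_inj : forall x y, eq_L0 I (j x) (j y) -> x = y;
  bfs_add : forall x y, eq_L0 I (j (x + y)) (fun t => j x t + j y t)%E;
  bfs_scale : forall (a : R) x, eq_L0 I (j (a *: x)) (fun t => a%:E * j x t)%E;
  bfs_sup : forall x y, exists z, eq_L0 I (j z) (fun t => maxe (j x t) (j y t));
  bfs_inf : forall x y, exists z, eq_L0 I (j z) (fun t => mine (j x t) (j y t));
  bfs_ideal : forall (f : R -> \bar R) y, measurable_fun I f ->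
    ae_on I (fun t => `|f t| <= `|j y t|)%E ->
    exists x, eq_L0 I (j x) f /\ `|x| <= `|y|;
  bfs_weak_unit : exists x, ae_on I (fun t => 0 < j x t)%E }.

Section Properties.
Context {R : realType} (I : set R) {E : completeNormedModType R}.
Variable j : E -> R -> \bar R.

Definition fatou_property : Prop :=
  forall (x : nat -> E) (f : R -> \bar R), measurable_fun I f ->
    (forall n, ae_on I (fun t => 0 <= j (x n) t)%E) ->
    has_ubound (range (fun n => `|x n|)) ->
    ae_on I (fun t => nondecreasing_seq (fun n => j (x n) t) /\
                      (j (x n) t @[n --> \oo] --> f t)) ->
    exists z, [/\ eq_L0 I (j z) f,
                  nondecreasing_seq (fun n => `|x n|) &
                  `|x n| @[n --> \oo] --> `|z|].

Record symmetric_space : Prop := {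
  symmetric_bfs : banach_function_space I j;
  symmetric_equimeasurable : forall (f : R -> \bar R) y, measurable_fun I f ->
    (forall l, distr I f l = distr I (j y) l) ->
    exists x, eq_L0 I (j x) f /\ `|x| = `|y| }.

Definition decreasing_cone : set E :=
  [set z | exists x, eq_L0 I (j z) (rearr I (j x))].

Definition compactly_fully_rotund (k : nat) (A : set E) : Prop :=
  forall x : nat -> E, (forall n, A (x n) /\ `|x n| = 1) ->
    (forall phi : 'I_k -> nat -> nat, (forall i, increasing_seq (phi i)) ->
      `|\sum_(i < k) x (phi i n)| @[n --> \oo] --> (k%:R : R)) ->
    precompact (range x).

Definition strictly_K_monotone (A : set E) : Prop :=
  forall x y, A x -> A y -> submaj I (j x) (j y) ->
    ~ eq_L0 I (rearr I (j x)) (rearr I (j y)) -> `|x| < `|y|.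

(* u n and v n are the elements (x n)^* and (y n)^* of E. *)
Definition decreasing_uniformly_K_monotone : Prop :=
  forall x y : nat -> E,
    (forall n, submaj I (j (x n.+1)) (j (x n)) /\ submaj I (j (x n)) (j (y n))) ->
    (exists l : R, (`|x n| @[n --> \oo] --> l) /\ (`|y n| @[n --> \oo] --> l)) ->
    exists u v : nat -> E,
      [/\ forall n, eq_L0 I (j (u n)) (rearr I (j (x n))),
          forall n, eq_L0 I (j (v n)) (rearr I (j (y n))) &
          `|u n - v n| @[n --> \oo] --> (0 : R)].

End Properties.

(* Main.v *)
(* The norm is monotone for majorization, by strict K-monotonicity. Write u_n, v_n
   for x_n^*, y_n^* and l > 0 for the common limit of the norms. Since t x^**(t) is
   additive on decreasing elements, a sum of k terms of (u_n), or of (v_n), with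
   indices at most M majorizes k u_M, so its norm is at least k l. After
   normalization both sequences are thus relatively compact by rotundity. If
   |u_n - v_n| stayed away from 0, then along a subsequence u_n -> p and v_n -> q
   in norm, and fast enough for the convergence to be a.e. and dominated by an
   element of E (Fatou property). Hence p and q are decreasing, p is majorized by
   q, and both have norm l, so strict K-monotonicity forces p = q.
   Dominated convergence needs the elements of E to be integrable on [0, t], which
   also follows from strict K-monotonicity: see cumul_lty. *)
Require Import Defs.
From mathcomp Require Import all_boot all_order all_algebra.
From mathcomp Require Import all_classical all_reals all_analysis.
From mathcomp Require Import measurable_realfun.
From mathcomp Require Import lra.

Set Implicit Arguments.
Unset Strict Implicit.
Unset Printing Implicit Defensive.

Import Order.TTheory GRing.Theory Num.Theory.
Import numFieldNormedType.Exports.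
Local Open Scope classical_set_scope.
Local Open Scope ring_scope.

(** * Distribution functions and decreasing rearrangements on $[0,\alpha)$ *)

Section Rearrangement.
Context {R : realType} (alpha : \bar R).
Hypothesis alpha_ge0 : (0 <= alpha)%E.
Local Notation mu := (@lebesgue_measure R).
Local Notation I := (base_interval alpha).
Implicit Types (f g : R -> \bar R) (l t : R).

Lemma base_interval_fin (r : R) : base_interval r%:E = `[0, r[%classic.
Proof.
by apply/seteqP; split=> t /=; rewrite in_itv /= -lte_fin; [case=> -> ->|case/andP].
Qed.

Lemma base_interval_pinfty : base_interval (+oo%E : \bar R) = `[0, +oo[%classic.
Proof.
apply/seteqP; split=> t /=; first by rewrite in_itv /= andbT => -[].
by rewrite in_itv /= andbT => t0; split => //; rewrite ltry.
Qed.

Lemma measurable_base_interval (a : \bar R) : measurable (base_interval a).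
Proof.
case: a => [r| |]; rewrite ?base_interval_fin ?base_interval_pinfty//.
by rewrite (_ : base_interval _ = set0)//; apply/seteqP; split=> t //= -[].
Qed.

Lemma measure_base_interval (a : \bar R) : (0 <= a)%E ->
  mu (base_interval a) = a.
Proof.
case: a => [r| |]// r0; rewrite ?base_interval_fin ?base_interval_pinfty.
  rewrite lebesgue_measure_itv /= lte_fin oppr0 adde0.
  by move: r0; rewrite lee_fin le_eqVlt => /predU1P[<-|->]//; rewrite ltxx.
by rewrite lebesgue_measure_itv /= ltry.
Qed.

Lemma measurable_superlevel f (l : R) : measurable_fun I f ->
  measurable (I `&` [set s | (l%:E < `|f s|)%E]).
Proof.
move=> mf; apply: emeasurable_fun_o_infty; first exact: measurable_base_interval.
exact: measurableT_comp.
Qed.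

Lemma distr_le f (l : R) : measurable_fun I f -> (distr I f l <= alpha)%E.
Proof.
move=> mf; rewrite -[leRHS]measure_base_interval//.
apply: le_measure; rewrite ?inE.
- exact: measurable_superlevel.
- exact: measurable_base_interval.
- exact: subIsetl.
Qed.

Lemma distr_antitone f (l m : R) : measurable_fun I f -> l <= m ->
  (distr I f m <= distr I f l)%E.
Proof.
move=> mf lm; apply: le_measure; rewrite ?inE; try exact: measurable_superlevel.
by move=> t /= [It mt]; split=> //; apply: le_lt_trans mt; rewrite lee_fin.
Qed.

(** The set $\{|f|>l\}$ is the increasing union of the sets $\{|f|>l+1/(n+1)\}$, so continuity of
    the measure from below applies. *)
Lemma distr_right_continuous f (l t : R) : measurable_fun I f ->
  (forall m, l < m -> (distr I f m <= t%:E)%E) -> (distr I f l <= t%:E)%E.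
Proof.
move=> mf H.
pose F (n : nat) := I `&` [set s | ((l + n.+1%:R^-1)%:E < `|f s|)%E].
have mF n : measurable (F n) by exact: measurable_superlevel.
have FE : I `&` [set s | (l%:E < `|f s|)%E] = \bigcup_n F n.
  apply/seteqP; split=> [s /= [Is ls]|s /= [n _ [Is ls]]].
    suff [n ln] : exists n : nat, ((l + n.+1%:R^-1)%:E < `|f s|)%E by exists n.
    case: (`|f s|%E) ls => [r| |] //.
    - rewrite lte_fin => lr; have [n nr] := ltr_add_invr lr.
      by exists n; rewrite lte_fin.
    - by move=> _; exists 0%N; rewrite ltry.
  split=> //; apply: lt_trans ls.
  by rewrite lte_fin ltrDl invr_gt0 ltr0n.
rewrite /distr FE.
have cvF : mu (F n) @[n --> \oo] --> mu (\bigcup_n F n).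
  apply: nondecreasing_cvg_mu; [exact: mF|exact: bigcupT_measurable|].
  move=> m n mn; apply/subsetPset => s /= [Is ls]; split => //.
  apply: le_lt_trans ls; rewrite lee_fin lerD2l lef_pV2 ?posrE ?ltr0n//.
  by rewrite ler_nat ltnS.
rewrite -(cvg_lim _ cvF)//; apply: lime_le; first by apply/cvg_ex; eexists; exact: cvF.
by apply: nearW => n; apply: H; rewrite ltrDl invr_gt0 ltr0n.
Qed.

Lemma rearr_ge0 f t : (0 <= rearr I f t)%E.
Proof. by apply: le_ereal_inf_tmp => _ [l [l0 _] <-]; rewrite lee_fin ltW. Qed.

Lemma rearr_antitone f (s t : R) : s <= t -> (rearr I f t <= rearr I f s)%E.
Proof.
move=> st; apply: ereal_inf_le_tmp => _ [l [l0 dl] <-]; exists l => //; split=> //.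
by apply: le_trans dl _; rewrite lee_fin.
Qed.

(** Right continuity of the distribution function turns $f^*(t)\le l$ into $d_f(l)\le t$, although
    $f^*(t)$ is only an infimum, and even for $l=0$, which that infimum excludes. Every superlevel
    set of a rearrangement is computed from this equivalence. *)
Lemma gt_rearr f (l t : R) : measurable_fun I f -> 0 <= l ->
  (l%:E < rearr I f t)%E = (t%:E < distr I f l)%E.
Proof.
move=> mf l0; apply/idP/idP; apply: contraTT; rewrite -!leNgt.
  move=> dl; apply/lee_addgt0Pr => e e0.
  apply: ereal_inf_lbound; exists (l + e) => //; split; first by rewrite ltr_wpDl.
  by apply: le_trans dl; apply: distr_antitone => //; rewrite lerDl ltW.
move=> rl; apply: distr_right_continuous => // m lm.
have : (rearr I f t < m%:E)%E by apply: le_lt_trans rl _; rewrite lte_fin.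
move=> /ereal_inf_lt[_ [p [p0 dp] <-]]; rewrite lte_fin => pm.
by apply: le_trans dp; apply: distr_antitone => //; exact: ltW.
Qed.

(** By [gt_rearr], $\{f^*>r\}$ is the ray $\{t<d_f(r)\}$ when $r\ge0$, and it is the whole line when
    $r<0$. *)
Lemma measurable_rearr f D : measurable_fun I f -> measurable_fun D (rearr I f).
Proof.
move=> mf mD; apply: (measurability _ (ErealGenOInfty.measurableE R)) => //.
move=> _ [_ [r ->] <-]; apply: measurableI => //.
have [r0|r0] := ltP r 0.
  rewrite (_ : _ @^-1` _ = setT)//; apply/seteqP; split=> // t _ /=.
  rewrite in_itv /= andbT; apply: lt_le_trans (rearr_ge0 f t).
  by rewrite lte_fin.
rewrite (_ : _ @^-1` _ = [set t | (t%:E < distr I f r)%E]).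
  by rewrite -[X in measurable X]setTI; exact: emeasurable_fun_infty_o.
by apply/seteqP; split=> t /=; rewrite in_itv /= andbT gt_rearr.
Qed.

Lemma superlevel_rearr f (l : R) : measurable_fun I f -> 0 <= l ->
  I `&` [set s | (l%:E < `|rearr I f s|)%E] = base_interval (distr I f l).
Proof.
move=> mf l0; apply/seteqP; split=> t /=.
  by rewrite gee0_abs ?rearr_ge0// gt_rearr// => -[[t0 _] tl].
move=> -[t0 tl]; rewrite gee0_abs ?rearr_ge0// gt_rearr//; split=> //; split=> //.
by apply: lt_le_trans tl _; exact: distr_le.
Qed.

Lemma distr_lt0 f (l : R) : l < 0 -> distr I f l = mu I.
Proof.
move=> l0; rewrite /distr (_ : [set s | _] = setT) ?setIT//.
apply/seteqP; split=> // s _ /=; apply: lt_le_trans (abse_ge0 _).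
by rewrite lte_fin.
Qed.

Lemma distr_rearr f (l : R) : measurable_fun I f ->
  distr I (rearr I f) l = distr I f l.
Proof.
move=> mf; have [l0|l0] := ltP l 0; first by rewrite !distr_lt0.
by rewrite [LHS]/distr superlevel_rearr// measure_base_interval// measure_ge0.
Qed.

Lemma eq_distr f g : measurable_fun I f -> measurable_fun I g ->
  eq_L0 I f g -> distr I f = distr I g.
Proof.
move=> mf mg [N [mN N0 sN]]; apply/funext => l; rewrite /distr.
have key f' g' (mf' : measurable_fun I f') (mg' : measurable_fun I g') :
    (forall s, ~ N s -> I s -> f' s = g' s) ->
    (mu (I `&` [set s | (l%:E < `|f' s|)%E]) <=
     mu (I `&` [set s | (l%:E < `|g' s|)%E]))%E.
  move=> H; rewrite -[leRHS](measureU0 _ mN N0); last exact: measurable_superlevel.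
  apply: le_measure; rewrite ?inE; first exact: measurable_superlevel.
    by apply: measurableU => //; exact: measurable_superlevel.
  move=> s [Is ls] /=; have [Ns|Ns] := pselect (N s); first by right.
  by left; split=> //; rewrite -H.
have H s : ~ N s -> I s -> f s = g s.
  by move=> Ns; apply: contrapT => fg; apply: Ns; apply: sN.
apply/eqP; rewrite eq_le !key// => s Ns Is; by rewrite H.
Qed.

Lemma eq_rearr f g : measurable_fun I f -> measurable_fun I g ->
  eq_L0 I f g -> rearr I f = rearr I g.
Proof.
by move=> mf mg fg; apply/funext => t; rewrite /rearr (eq_distr mf mg fg).
Qed.

Lemma rearr_rearr f : measurable_fun I f -> rearr I (rearr I f) = rearr I f.
Proof.
move=> mf; apply/funext => t; rewrite /rearr; congr (ereal_inf _).
by apply/seteqP; split=> _ [l [l0 dl] <-]; exists l => //; split => //;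
   rewrite ?distr_rearr// -distr_rearr.
Qed.

End Rearrangement.

(** * Calculus of properties holding almost everywhere on a set *)

Section AlmostEverywhere.
Context {R : realType}.
Implicit Types (I : set R) (P Q : R -> Prop) (f g h : R -> \bar R).
Let ae_filter := ae_filter_ringOfSetsType (@lebesgue_measure R).

Lemma ae_onW I P : (forall t, I t -> P t) -> ae_on I P.
Proof. by move=> H; apply: aeW. Qed.

Lemma ae_onS I P Q : (forall t, I t -> P t -> Q t) -> ae_on I P -> ae_on I Q.
Proof.
have F := ae_filter; move=> H; rewrite /ae_on.
by apply: filterS => t Pt It; apply: H => //; exact: Pt.
Qed.

Lemma ae_on_sub I (J : set R) P : J `<=` I -> ae_on I P -> ae_on J P.
Proof.
have F := ae_filter; move=> JI; rewrite /ae_on.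
by apply: filterS => t Pt Jt; apply: Pt; exact: JI.
Qed.

Lemma ae_onI I P Q : ae_on I P -> ae_on I Q -> ae_on I (fun t => P t /\ Q t).
Proof.
have F := ae_filter; rewrite /ae_on.
by apply: filterS2 => t Pt Qt It; split; [exact: Pt|exact: Qt].
Qed.

Lemma ae_on_foralln I (P : nat -> R -> Prop) :
  (forall n, ae_on I (P n)) -> ae_on I (fun t => forall n, P n t).
Proof.
have F := ae_filter; move=> /ae_foralln; apply: filterS.
by move=> t Pt It n; exact: Pt.
Qed.

Lemma eq_L0_sym I f g : eq_L0 I f g -> eq_L0 I g f.
Proof. exact: ae_onS. Qed.

Lemma eq_L0_trans I f g h : eq_L0 I f g -> eq_L0 I g h -> eq_L0 I f h.
Proof. by move=> fg gh; apply: ae_onS (ae_onI fg gh) => t _ [-> ->]. Qed.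

End AlmostEverywhere.

(** * Almost everywhere antitone functions are their own rearrangements *)

Section Antitone.
Context {R : realType} (alpha : \bar R).
Hypothesis alpha_ge0 : (0 <= alpha)%E.
Local Notation mu := (@lebesgue_measure R).
Local Notation I := (base_interval alpha).
Implicit Types (f g : R -> \bar R).

Lemma lte_exists_rat (a b : \bar R) : (0 <= a)%E -> (a < b)%E ->
  exists q : rat, (a < (ratr q)%:E)%E /\ ((ratr q)%:E < b)%E.
Proof.
case: a => [a| |] // _ ab; last by rewrite ltNge leey in ab.
(* The upper end may be $+\infty$, so a real [c] is interposed before using the density of the
   rationals. *)
have [c [ac cb]] : exists c, a < c /\ (c%:E <= b)%E.
  case: b ab => [b| |] //; first by rewrite lte_fin => ab; exists b.
  by move=> _; exists (a + 1); rewrite ltrDl ltr01 leey.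
have [q] := rat_in_itvoo ac; rewrite in_itv /= => /andP[aq qc].
by exists q; rewrite lte_fin; split => //; apply: lt_le_trans cb; rewrite lte_fin.
Qed.

(* Off the exceptional set f s <= f^* t <= f t for t < s; the intervals
   (f^* t, f t) are thus pairwise disjoint, so all but countably many of them
   are empty. *)
Lemma rearr_ae_antitone f (D : set R) : measurable_fun I f -> ae_on I D ->
  (forall s, I s -> D s -> (0 <= f s)%E) ->
  (forall s t, I s -> D s -> I t -> D t -> s <= t -> (f t <= f s)%E) ->
  eq_L0 I (rearr I f) f.
Proof.
move=> mf aeD f0 fD; have [N [mN N0 sN]] := aeD.
have ND t : I t -> ~ N t -> D t.
  by move=> It Nt; apply: contrapT => Dt; apply: Nt; apply: sN => /(_ It).
(* Up to the null set [N], the set $\{f>f(t)\}$ lies in $[0,t)$, so its measure is at most $t$. *)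
have rearr_le t : I t -> D t -> (rearr I f t <= f t)%E.
  move=> It Dt; rewrite leNgt; apply/negP => ft.
  have ftE : f t = (fine (f t))%:E.
    by rewrite fineK// ge0_fin_numE ?f0//; apply: lt_le_trans ft _; exact: leey.
  have l0 : 0 <= fine (f t) by rewrite fine_ge0 ?f0.
  move: ft; rewrite {1}ftE gt_rearr// ltNge => /negP; apply.
  have [t0 ta] := It.
  rewrite -(@measure_base_interval _ t%:E) ?lee_fin//.
  rewrite -(measureU0 _ mN N0); last exact: measurable_base_interval.
  apply: le_measure; rewrite ?inE; first exact: measurable_superlevel.
    by apply: measurableU => //; exact: measurable_base_interval.
  move=> s /= [Is]; rewrite -ftE => fts.
  have [Ns|Ns] := pselect (N s); first by right.
  left; split; first by case: Is.
  rewrite lte_fin ltNge; apply/negP => ts; have Ds := ND _ Is Ns.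
  by move: fts; rewrite gee0_abs ?f0// ltNge fD.
(* Otherwise $f$ exceeds $f^*(t)$ on $[0,s)$ up to [N], so the distribution function at $f^*(t)$ is
   at least $s>t$, and [gt_rearr] yields $f^*(t)<f^*(t)$. *)
have le_rearr s t : I s -> D s -> I t -> t < s -> (f s <= rearr I f t)%E.
  move=> Is Ds It ts; rewrite leNgt; apply/negP => ft.
  have r0 := rearr_ge0 alpha f t.
  have rE : rearr I f t = (fine (rearr I f t))%:E.
    by rewrite fineK// ge0_fin_numE//; apply: lt_le_trans ft _; exact: leey.
  have l0 : 0 <= fine (rearr I f t) by rewrite fine_ge0.
  suff : ((fine (rearr I f t))%:E < rearr I f t)%E by rewrite -rE ltxx.
  rewrite gt_rearr//; have [s0 sa] := Is.
  apply: (@lt_le_trans _ _ s%:E); first by rewrite lte_fin.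
  rewrite -(@measure_base_interval _ s%:E) ?lee_fin//.
  rewrite -[leRHS](measureU0 _ mN N0); last exact: measurable_superlevel.
  apply: le_measure; rewrite ?inE; first exact: measurable_base_interval.
    by apply: measurableU => //; exact: measurable_superlevel.
  move=> u /= [u0 us]; have Iu : I u by split=> //; exact: lt_trans us sa.
  have [Nu|Nu] := pselect (N u); first by right.
  left; split => //; rewrite -rE; have Du := ND _ Iu Nu.
  rewrite gee0_abs ?f0//; apply: lt_le_trans ft _; apply: fD => //.
  by rewrite ltW// -lte_fin.
pose B := [set t | I t /\ D t /\ (rearr I f t < f t)%E].
have [q qB] : exists q : R -> rat, forall t, B t ->
    (rearr I f t < (ratr (q t))%:E)%E /\ ((ratr (q t))%:E < f t)%E.
  have /choice[q qB] : forall t, exists q : rat, B t ->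
      (rearr I f t < (ratr q)%:E)%E /\ ((ratr q)%:E < f t)%E.
    move=> t; have [[It [Dt ft]]|nB] := pselect (B t); last by exists 0.
    by have [q qt] := lte_exists_rat (rearr_ge0 alpha f t) ft; exists q.
  by exists q.
have qlt s t : B s -> B t -> t < s -> q s < q t.
  move=> Bs Bt ts; have [Is [Ds _]] := Bs; have [It [Dt _]] := Bt.
  rewrite -(ltr_rat R) -lte_fin; apply: lt_trans (qB _ Bs).2 _.
  by apply: le_lt_trans (qB _ Bt).1; exact: le_rearr.
have cB : countable B.
  apply/countable_injP; exists (fun t => pickle (q t)).
  move=> s t /set_mem Bs /set_mem Bt /(pcan_inj pickleK) qst.
  by case: (ltgtP s t) => // st; [have := qlt _ _ Bt Bs st|have := qlt _ _ Bs Bt st];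
     rewrite qst ltxx.
have aeB : ae_on I (fun t => ~ B t).
  exists B; split; first exact: countable_measurable.
    exact: countable_lebesgue_measure0.
  by move=> t /= /not_implyP[_] /contrapT.
apply: ae_onS (ae_onI aeD aeB) => t It [Dt Bt]; apply/eqP.
rewrite eq_le rearr_le//= leNgt; apply/negP => ft.
by apply: Bt; split.
Qed.

End Antitone.

(** * Counting the natural numbers below an extended real *)

Section UnitSteps.
Context {R : realType}.
Implicit Types (a : \bar R) (r : R) (n N : nat).
Local Open Scope ereal_scope.

Let step a n : \bar R := ((n%:R%:E < a)%E%:R)%:E.

Let step_ge0 a n : 0 <= step a n.
Proof. by rewrite lee_fin ler0n. Qed.

(** For $r\ge0$ the partial sum is $\min(\lceil r\rceil,N)$; this bound and the next one squeeze it
    without mentioning the ceiling. *)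
Let step_sum_ge (r : R) N : ((Num.min r N%:R)%:E <= \sum_(0 <= n < N) step r%:E n).
Proof.
elim: N => [|N ih]; first by rewrite big_nil lee_fin ge_min lexx orbT.
rewrite big_nat_recr //= /step lte_fin; case: (ltP (N%:R)%R r) => [Nr|rN].
  apply: (@le_trans _ _ (N%:R%:E + 1%:E)).
    by rewrite lee_fin ge_min -natr1 lexx orbT.
  by apply: leeD => //; apply: le_trans ih; rewrite lee_fin le_min lexx (ltW Nr).
rewrite adde0; apply: le_trans ih; rewrite lee_fin (min_idPl rN).
by rewrite ge_min lexx.
Qed.

Let step_sum_le (r : R) N : (0 <= r)%R ->
  \sum_(0 <= n < N) step r%:E n <= (Num.min (r + 1) N%:R)%:E.
Proof.
move=> r0; elim: N => [|N ih].
  by rewrite big_nil lee_fin le_min lexx andbT addr_ge0.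
rewrite big_nat_recr //= /step lte_fin; case: (ltP (N%:R)%R r) => [Nr|rN].
  apply: (@le_trans _ _ (N%:R%:E + 1%:E)); last first.
    by rewrite lee_fin le_min -natr1 lexx andbT lerD2r ltW.
  by apply: leeD => //; apply: le_trans ih _; rewrite lee_fin ge_min lexx orbT.
rewrite adde0; apply: le_trans ih _; rewrite lee_fin le_min ge_min lexx/=.
by rewrite ge_min ler_nat leqnSn orbT.
Qed.

(** For finite $a\ge0$ the series equals $\lceil a\rceil$; for $a=+\infty$ all its terms are 1, so
    its partial sums are unbounded. *)
Lemma le_unit_steps a : a <= \sum_(n <oo) ((n%:R%:E < a)%E%:R)%:E.
Proof.
have part_le N : \sum_(0 <= n < N) step a n <= \sum_(n <oo) step a n.
  by apply: nneseries_lim_ge => n _ _; exact: step_ge0.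
case: a part_le => [r| |] part_le; last by rewrite leNye.
  have [N rN] : exists N : nat, (r <= N%:R)%R.
    by exists (Num.bound r); exact/ltW/unstable.ltr_bound.
  apply: le_trans (part_le N); apply: le_trans (step_sum_ge r N).
  by rewrite (min_idPl rN).
rewrite leye_eq; apply/eqP/eqyP => r r0.
apply: (@le_trans _ _ (Num.bound r)%:R%:E).
  by rewrite lee_fin; exact/ltW/unstable.ltr_bound.
apply: le_trans (part_le (Num.bound r)).
rewrite (eq_bigr (fun=> 1%:E)); last by move=> n _; rewrite /step ltry.
by rewrite sumEFin big_const_nat iter_addr_0 subn0.
Qed.

Lemma unit_steps_le a : 0 <= a ->
  \sum_(n <oo) ((n%:R%:E < a)%E%:R)%:E <= a + 1.
Proof.
case: a => [r| |] // r0; last by rewrite leey.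
apply: lime_le; first by apply: is_cvg_nneseries => n _ _; exact: step_ge0.
apply: nearW => N; apply: le_trans (step_sum_le N _) _; first by rewrite -lee_fin.
by rewrite lee_fin ge_min lexx.
Qed.

End UnitSteps.

(** * Integrals over initial segments, majorization and local integrability *)

Section Integrals.
Context {R : realType} (alpha : \bar R).
Hypothesis alpha_ge0 : (0 <= alpha)%E.
Local Notation mu := (@lebesgue_measure R).
Local Notation I := (base_interval alpha).
Implicit Types (f g : R -> \bar R) (t : R).
Local Open Scope ereal_scope.

(** The integral in [maximal_rearr] runs over $[0,t]$, which may leave $I$. Intersecting with $I$
    makes a.e. equality on $I$ applicable, and does not change the integral of a rearrangement,
    which vanishes beyond $I$. *)
Definition initial_segment (a : \bar R) t : set R := base_interval a `&` `[0%R, t].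
Local Notation A := (initial_segment alpha).

Lemma measurable_initial_segment a t : measurable (initial_segment a t).
Proof. by apply: measurableI => //; exact: measurable_base_interval. Qed.

Lemma sub_initial_segment a t : initial_segment a t `<=` base_interval a.
Proof. by move=> s []. Qed.

Lemma measurable_funSI f t : measurable_fun I f -> measurable_fun (A t) f.
Proof.
by apply: measurable_funS; [exact: measurable_base_interval|exact: sub_initial_segment].
Qed.

Lemma eq_L0_integral f g t : measurable_fun I f -> measurable_fun I g ->
  eq_L0 I f g -> \int[mu]_(s in A t) f s = \int[mu]_(s in A t) g s.
Proof.
move=> mf mg fg; apply: ae_eq_integral.
- exact: measurable_initial_segment.
- exact: measurable_funSI.
- exact: measurable_funSI.
- by apply: ae_eq_subset fg; exact: sub_initial_segment.
Qed.

Lemma measure_initial_segment_lty a t : mu (initial_segment a t) < +oo.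
Proof.
apply: (@le_lt_trans _ _ (mu `[0%R, t])).
  apply: le_measure; rewrite ?inE//; first exact: measurable_initial_segment.
  exact: subIsetr.
by rewrite lebesgue_measure_itv /=; case: ifP => //; rewrite ltry.
Qed.

Lemma rearr_eq0 f t : measurable_fun I f -> (0 <= t)%R -> ~ I t ->
  rearr I f t = 0.
Proof.
move=> mf t0 nIt; apply/eqP; rewrite eq_le rearr_ge0 andbT leNgt gt_rearr//.
rewrite -leNgt; apply: le_trans (distr_le _ _ mf) _ => //.
by rewrite leNgt; apply/negP => ta; apply: nIt.
Qed.

Lemma integral_rearr f t : measurable_fun I f ->
  \int[mu]_(s in `[0%R, t]) rearr I f s = \int[mu]_(s in A t) rearr I f s.
Proof.
move=> mf; rewrite /initial_segment setIC integral_mkcondr.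
apply: eq_integral => s; rewrite inE /= in_itv /= => /andP[s0 _].
rewrite patchE; case: ifPn => //; rewrite notin_setE => nIs.
exact: rearr_eq0.
Qed.

(** Multiplying by $t>0$ removes the factor $t^{-1}$ of [maximal_rearr], and leaves integrals that
    are additive on decreasing functions. *)
Lemma submajP f g : measurable_fun I f -> measurable_fun I g ->
  submaj I f g <-> (forall t, (0 < t)%R ->
    \int[mu]_(s in A t) rearr I f s <= \int[mu]_(s in A t) rearr I g s).
Proof.
move=> mf mg; have E t : (0 < t)%R ->
    (maximal_rearr I f t <= maximal_rearr I g t) =
    (\int[mu]_(s in A t) rearr I f s <= \int[mu]_(s in A t) rearr I g s).
  move=> t0; rewrite /maximal_rearr (integral_rearr t mf) (integral_rearr t mg).
  by rewrite lee_pmul2l// lte_fin invr_gt0.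
by split=> H t t0; [rewrite -(E t t0)|rewrite (E t t0)]; exact: H.
Qed.

Lemma integral_superlevel f t (n : nat) : measurable_fun I f ->
  \int[mu]_(s in A t) ((n%:R%:E < `|f s|)%E%:R)%:E =
  mu (A t `&` [set s | n%:R%:E < `|f s|]).
Proof.
move=> mf; have mI := measurable_superlevel n%:R mf.
pose S := I `&` [set s | (n%:R : R)%:E < `|f s|].
transitivity (\int[mu]_(s in A t) (\1_S s)%:E).
  apply: eq_integral => s; rewrite inE => -[Is _]; rewrite indicE.
  congr ((_ : bool)%:R)%:E; apply/idP/idP; first by move=> fs; rewrite inE.
  by rewrite inE => -[].
rewrite integral_indic//; last exact: measurable_initial_segment.
congr (mu _); apply/seteqP; split=> s /=.
  by move=> -[[? ?] ?]; split.
by move=> -[[? ?] ?]; split => //; split.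
Qed.

Lemma measurable_step f t (n : nat) : measurable_fun I f ->
  measurable_fun (A t) (fun s => ((n%:R%:E < `|f s|)%E%:R)%:E : \bar R).
Proof.
move=> mf; have mI := measurable_superlevel n%:R mf.
pose S := I `&` [set s | (n%:R : R)%:E < `|f s|].
apply: (@eq_measurable_fun _ _ _ _ _ (EFin \o \1_S)).
  move=> s; rewrite inE => -[Is _] /=; rewrite indicE.
  congr ((_ : bool)%:R)%:E; apply/idP/idP; last by move=> fs; rewrite inE.
  by rewrite inE => -[].
by apply/measurable_EFinP; exact: measurable_indic.
Qed.

(** Since $\{f^*>n\}$ is the interval $[0,d_f(n))$, the right side is $\min(t,d_f(n))$ when $t$ lies
    in $I$, or simply $d_f(n)$ when it lies beyond. The left side is bounded by $d_f(n)$ and by the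
    measure of [A t]. *)
Lemma le_measure_superlevel_rearr f t (n : nat) : measurable_fun I f ->
  mu (A t `&` [set s | n%:R%:E < `|f s|]) <=
  mu (A t `&` [set s | n%:R%:E < `|rearr I f s|]).
Proof.
move=> mf; have mS := measurable_superlevel n%:R mf.
have mA := measurable_initial_segment alpha t.
have mr : measurable_fun I (rearr I f) := measurable_rearr mf.
have mAS g (mg : measurable_fun I g) :
    measurable (A t `&` [set s | n%:R%:E < `|g s|]).
  rewrite [X in measurable X](_ : _ = A t `&` (I `&` [set s | n%:R%:E < `|g s|])).
    by apply: measurableI => //; exact: measurable_superlevel.
  by apply/seteqP; split => s /= [[? ?]]; [|case].
have E : A t `&` [set s | n%:R%:E < `|rearr I f s|] =
    A t `&` base_interval (distr I f n%:R).
  by rewrite -(superlevel_rearr alpha_ge0 mf)// setIA /initial_segment;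
    congr (_ `&` _); apply/seteqP; split=> s /=; [|case] => -[].
have [td|dt] := leP t%:E (distr I f n%:R); last first.
  apply: (@le_trans _ _ (distr I f n%:R)).
    apply: le_measure; rewrite ?inE//; first exact: mAS.
    by move=> s [[]].
  rewrite -[leLHS](@measure_base_interval _ (distr I f n%:R))// E.
  apply: le_measure; rewrite ?inE//; first exact: measurable_base_interval.
    by apply: measurableI => //; exact: measurable_base_interval.
  move=> s /= [s0 sd]; split; last by split.
  split; last by rewrite /= in_itv /= s0 -lee_fin ltW// (lt_trans sd).
  by split => //; apply: lt_le_trans sd _; exact: distr_le.
apply: (@le_trans _ _ (mu (A t))).
  by apply: le_measure; rewrite ?inE//; exact: mAS.
(* The segment [A t] is closed at $t$ while $[0,d_f(n))$ is half-open, so the point $t$ can be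
   missing when $d_f(n)=t$; adding this null set repairs the inclusion. *)
rewrite -[leRHS](@measureU0 _ _ _ mu _ [set t])//; last 2 first.
- exact: mAS.
- exact: lebesgue_measure_set1.
rewrite E; apply: le_measure; rewrite ?inE//.
  apply: measurableU => //; apply: measurableI => //.
  exact: measurable_base_interval.
move=> s /= [Is]; rewrite /= in_itv /= => /andP[s0].
rewrite le_eqVlt => /predU1P[->|st]; [by right|left; split; split => //].
- by rewrite /= in_itv /= s0 ltW.
- by apply: lt_le_trans td; rewrite lte_fin.
Qed.

(* Discrete layer cake: |f| <= \sum_n 1_{|f| > n} and \sum_n 1_{f^* > n} <= f^* + 1. *)
Lemma integral_lty_of_rearr f t : measurable_fun I f ->
  \int[mu]_(s in A t) rearr I f s < +oo -> \int[mu]_(s in A t) `|f s| < +oo.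
Proof.
move=> mf rfoo; have mA := measurable_initial_segment alpha t.
have mr : measurable_fun I (rearr I f) := measurable_rearr mf.
pose S g s := \sum_(n <oo) ((n%:R%:E < `|g s|)%E%:R)%:E : \bar R.
have mS g : measurable_fun I g -> measurable_fun (A t) (S g).
  move=> mg; apply: ge0_emeasurable_sum => [n s _ _|n _].
    by rewrite lee_fin ler0n.
  exact: measurable_step.
have intS g : measurable_fun I g -> \int[mu]_(s in A t) S g s =
    \sum_(n <oo) mu (A t `&` [set s | n%:R%:E < `|g s|]).
  move=> mg; rewrite integral_nneseries//; last by move=> n; exact: measurable_step.
  by apply: eq_eseriesr => n _; exact: integral_superlevel.
have S0 g s : 0 <= S g s by apply: nneseries_ge0 => n _ _; rewrite lee_fin ler0n.
apply: (@le_lt_trans _ _ (\int[mu]_(s in A t) S f s)).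
  apply: ge0_le_integral => //; [|exact: mS|by move=> s _; exact: le_unit_steps].
  by apply: measurableT_comp => //; exact: measurable_funSI.
rewrite intS//; apply: (@le_lt_trans _ _ (\int[mu]_(s in A t) S (rearr I f) s)).
  rewrite intS//; apply: lee_nneseries => [n _ _|n _].
    exact: measure_ge0.
  exact: le_measure_superlevel_rearr.
(* The extra 1 contributes only the measure of [A t], which is finite even when $\alpha=+\infty$. *)
apply: (@le_lt_trans _ _ (\int[mu]_(s in A t) (rearr I f s + 1))).
  apply: ge0_le_integral => //; first exact: mS.
  - by apply: emeasurable_funD => //; exact: measurable_funSI.
  - move=> s _; rewrite -[X in X + _](gee0_abs (rearr_ge0 alpha f s)).
    exact: unit_steps_le.
rewrite ge0_integralD//; last 2 first.
- by move=> s _; exact: rearr_ge0.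
- exact: measurable_funSI.
by rewrite integral_cst// mul1e lte_add_pinfty// measure_initial_segment_lty.
Qed.

End Integrals.

(** * Decreasing elements of a symmetric space *)

Section SymmetricSpace.
Context {R : realType} (alpha : \bar R).
Hypothesis alpha_ge0 : (0 <= alpha)%E.
Local Notation mu := (@lebesgue_measure R).
Local Notation I := (base_interval alpha).
Local Notation A := (initial_segment alpha).
Context {E : completeNormedModType R} (j : E -> R -> \bar R).
Hypothesis hE : symmetric_space I j.
Implicit Types (x y w p : E) (t : R).

Let hB := symmetric_bfs hE.

Let mj x : measurable_fun I (j x). Proof. exact: bfs_measurable hB x. Qed.

Definition decreasing_elt x : Prop := eq_L0 I (j x) (rearr I (j x)).

(** For $t>0$ this is $t\,x^{**}(t)$. *)
Definition cumul x t : \bar R := (\int[mu]_(s in A t) rearr I (j x) s)%E.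

(** Rearrangement is idempotent, so the witness in [decreasing_cone] can be taken to be the element
    itself. *)
Lemma decreasing_coneP x : decreasing_cone I j x <-> decreasing_elt x.
Proof.
split=> [[y xy]|dx]; last by exists x.
have mr : measurable_fun I (rearr I (j y)) by exact: measurable_rearr.
by rewrite /decreasing_elt (eq_rearr (mj x) mr xy) rearr_rearr.
Qed.

Lemma exists_rearr x : exists u, eq_L0 I (j u) (rearr I (j x)) /\ `|u| = `|x|.
Proof.
apply: (symmetric_equimeasurable hE); first exact: measurable_rearr.
by move=> l; rewrite distr_rearr.
Qed.

Lemma rearr_of_eq u x : eq_L0 I (j u) (rearr I (j x)) ->
  rearr I (j u) = rearr I (j x).
Proof.
move=> ux; have mr : measurable_fun I (rearr I (j x)) by exact: measurable_rearr.
by rewrite (eq_rearr (mj u) mr ux) rearr_rearr.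
Qed.

(** The set [D] allows all the a.e. identities available about [x] to be gathered before
    monotonicity is checked pointwise. *)
Lemma decreasing_elt_ae x (D : set R) : ae_on I D ->
  (forall s, I s -> D s -> (0 <= j x s)%E) ->
  (forall s t, I s -> D s -> I t -> D t -> s <= t -> (j x t <= j x s)%E) ->
  decreasing_elt x.
Proof. by move=> *; apply: eq_L0_sym; exact: (rearr_ae_antitone (D := D)). Qed.

Lemma decreasing_elt_inj x y : decreasing_elt x -> decreasing_elt y ->
  eq_L0 I (rearr I (j x)) (rearr I (j y)) -> x = y.
Proof.
move=> dx dy xy; apply: (bfs_inj hB); apply: eq_L0_trans dx _.
by apply: eq_L0_trans xy _; exact: eq_L0_sym.
Qed.

Lemma decreasing_eltD x y : decreasing_elt x -> decreasing_elt y ->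
  decreasing_elt (x + y).
Proof.
move=> dx dy; have D := ae_onI (bfs_add hB x y) (ae_onI dx dy).
apply: (decreasing_elt_ae D) => [s _ [-> [-> ->]]|].
  by rewrite adde_ge0// rearr_ge0.
move=> s t _ [-> [-> ->]] _ [-> [-> ->]] st.
by rewrite leeD// rearr_antitone.
Qed.

Lemma decreasing_eltZ (a : R) x : 0 <= a -> decreasing_elt x ->
  decreasing_elt (a *: x).
Proof.
move=> a0 dx; apply: (decreasing_elt_ae (ae_onI (bfs_scale hB a x) dx)).
  by move=> s _ [-> ->]; rewrite mule_ge0// rearr_ge0.
by move=> s t _ [-> ->] _ [-> ->] st; rewrite lee_wpmul2l// rearr_antitone.
Qed.

Lemma eq_L0_0 : eq_L0 I (j 0) (fun=> 0%E).
Proof.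
have := bfs_scale hB 0 0; rewrite scale0r; apply: ae_onS => t _ ->.
by rewrite mul0e.
Qed.

Lemma decreasing_elt0 : decreasing_elt 0.
Proof.
by apply: (decreasing_elt_ae eq_L0_0) => [s _ ->|s t _ -> _ ->].
Qed.

Lemma cumulE x t : decreasing_elt x -> cumul x t = (\int[mu]_(s in A t) j x s)%E.
Proof.
move=> dx; apply: eq_L0_integral; [exact: measurable_rearr|exact: mj|].
exact: eq_L0_sym.
Qed.

(** A sum of decreasing elements is decreasing, so $(x+y)^*=x^*+y^*$ a.e.; for general elements this
    fails. *)
Lemma cumulD x y t : decreasing_elt x -> decreasing_elt y ->
  (cumul (x + y)%R t = cumul x t + cumul y t)%E.
Proof.
move=> dx dy; have mr z D : measurable_fun D (rearr I (j z)).
  exact: measurable_rearr.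
rewrite /cumul -ge0_integralD//; last 5 first.
- exact: measurable_initial_segment.
- by move=> *; exact: rearr_ge0.
- exact: mr.
- by move=> *; exact: rearr_ge0.
- exact: mr.
apply: eq_L0_integral; [exact: mr|by apply: emeasurable_funD; exact: mr|].
have := ae_onI (bfs_add hB x y) (ae_onI dx (ae_onI dy (decreasing_eltD dx dy))).
by apply: ae_onS => s _ [jxy [jx [jy <-]]]; rewrite jxy jx jy.
Qed.

Lemma cumul0 t : cumul 0 t = 0%E.
Proof.
rewrite (cumulE _ decreasing_elt0) (@eq_L0_integral _ _ _ (cst 0%E))//.
- by rewrite integral0.
- exact: eq_L0_0.
Qed.

Lemma le_cumul_sum (T : finType) (x y : T -> E) t :
  (forall i, decreasing_elt (x i)) -> (forall i, decreasing_elt (y i)) ->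
  (forall i, (cumul (x i) t <= cumul (y i) t)%E) ->
  [/\ decreasing_elt (\sum_i x i), decreasing_elt (\sum_i y i) &
      (cumul (\sum_i x i)%R t <= cumul (\sum_i y i)%R t)%E].
Proof.
move=> dx dy xy.
(* The induction carries decreasingness of both partial sums, because [cumulD] requires it. *)
apply: (big_ind2 (fun a b => [/\ decreasing_elt a, decreasing_elt b &
  (cumul a t <= cumul b t)%E])) => [|a b c d [da db ab] [dc dd cd]|i _].
- by split; [exact: decreasing_elt0..|exact: lexx].
- split; [exact: decreasing_eltD..|].
  rewrite (cumulD t da dc) (cumulD t db dd); exact: leeD ab cd.
- by split.
Qed.

Lemma eq_submaj x y x' y' : rearr I (j x) = rearr I (j x') ->
  rearr I (j y) = rearr I (j y') -> submaj I (j x) (j y) -> submaj I (j x') (j y').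
Proof. by rewrite /submaj /maximal_rearr => -> ->. Qed.

Lemma submaj_cumul x y :
  submaj I (j x) (j y) <-> forall t, 0 < t -> (cumul x t <= cumul y t)%E.
Proof. exact: submajP. Qed.

(** If $x^*(t)=+\infty$, then $x^*=+\infty$ on $[0,t)$, a set of positive measure, whereas an
    element representing $x^*$ is finite a.e. *)
Lemma rearr_lty x t : 0 < t -> (rearr I (j x) t < +oo)%E.
Proof.
move=> t0; rewrite ltey; apply/eqP => rt.
have [u [ux _]] := exists_rearr x.
have [N [mN N0 sN]] := ae_onI ux (bfs_finite hB u).
have It : I t.
  by apply: contrapT => nIt; move: rt; rewrite rearr_eq0// ltW.
suff : (mu (base_interval t%:E) <= mu N)%E.
  by rewrite N0 measure_base_interval lee_fin; [rewrite leNgt t0|rewrite ltW].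
apply: le_measure; rewrite ?inE//; first exact: measurable_base_interval.
move=> s /= [s0 st]; apply: sN => /= /(_ _)[].
  by split => //; apply: lt_trans st _; case: It.
move=> ->; rewrite fin_numElt => /andP[_]; apply/negP; rewrite -leNgt -rt.
by apply: rearr_antitone; rewrite -lee_fin ltW.
Qed.

Lemma exists_abs x :
  exists a, eq_L0 I (j a) (fun t => `|j x t|%E) /\ `|a| <= `|x|.
Proof.
apply: (bfs_ideal hB); first exact: measurableT_comp.
by apply: ae_onW => t _; rewrite abse_id.
Qed.

(** * Norm monotonicity and local integrability from strict K-monotonicity *)

Section StrictlyMonotone.
Hypothesis hSKM : strictly_K_monotone I j (decreasing_cone I j).

(** Strict K-monotonicity covers distinct rearrangements; equal ones force [x = y], both elements
    being decreasing. *)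
Lemma submaj_norm_le x y : decreasing_elt x -> decreasing_elt y ->
  submaj I (j x) (j y) -> `|x| <= `|y|.
Proof.
move=> dx dy xy.
have [e|ne] := pselect (eq_L0 I (rearr I (j x)) (rearr I (j y))).
  by rewrite (decreasing_elt_inj dx dy e).
by apply/ltW/hSKM => //; exact/decreasing_coneP.
Qed.

(* If x^* were not integrable at 0 then x^{**} = +oo, hence 2x would be majorized
   by x. *)
Lemma cumul_lty x t : decreasing_elt x -> (cumul x t < +oo)%E.
Proof.
move=> dx; rewrite ltey; apply/eqP => xt.
have mr D : measurable_fun D (rearr I (j x)) by exact: measurable_rearr.
(* Divergence on one segment spreads to all: a larger segment has a larger integral, and shrinking
   to $[0,s]$ discards only values at most $x^*(s)<+\infty$ on a set of finite measure. *)
have xoo s : 0 < s -> cumul x s = +oo%E.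
  move=> s0; have [ts|st] := leP t s.
    apply/eqP; rewrite -leye_eq -xt; apply: ge0_subset_integral => //.
    - exact: measurable_initial_segment.
    - exact: measurable_initial_segment.
    - exact: mr.
    - by move=> *; exact: rearr_ge0.
    - move=> r [Ir]; rewrite /= in_itv /= => /andP[r0 rt]; split => //.
      by rewrite /= in_itv /= r0 (le_trans rt).
  apply/eqP; rewrite -leye_eq leNgt; apply/negP => xs.
  suff : (cumul x t < +oo)%E by rewrite xt ltxx.
  have mrA : measurable_fun (A t) (rearr I (j x) \_ (A s)).
    apply: (measurable_restrict _ (measurable_initial_segment _ _)
      (measurable_initial_segment _ _)).1.
    exact: mr.
  pose c := rearr I (j x) s; have c0 : (0 <= c)%E by exact: rearr_ge0.
  apply: (@le_lt_trans _ _ (\int[mu]_(r in A t) ((rearr I (j x) \_ (A s)) r + c))%E).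
    apply: ge0_le_integral => //.
    - exact: measurable_initial_segment.
    - by move=> *; exact: rearr_ge0.
    - exact: mr.
    - apply: emeasurable_funD; last exact: measurable_cst.
      exact: mrA.
    - move=> r [Ir]; rewrite /= in_itv /= => /andP[r0 rt]; rewrite patchE.
      case: ifPn => [_|]; first by rewrite leeDl.
      rewrite notin_setE add0e => nAs; apply: rearr_antitone.
      rewrite leNgt; apply/negP => rs; apply: nAs; split => //.
      by rewrite /= in_itv /= r0 ltW.
  rewrite ge0_integralD//; last 2 first.
  - exact: measurable_initial_segment.
  - by move=> r _; rewrite patchE; case: ifP => // _; exact: rearr_ge0.
  rewrite -integral_mkcondr integral_cst; last exact: measurable_initial_segment.
  rewrite lte_add_pinfty//.
    rewrite (_ : A t `&` A s = A s)//; apply/setIidPr => r [Ir].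
    rewrite /= in_itv /= => /andP[r0 rs]; split => //.
    by rewrite /= in_itv /= r0 (le_trans rs)// ltW.
  rewrite lte_mul_pinfty// ?measure_initial_segment_lty//.
  by rewrite ge0_fin_numE// rearr_lty.
have d2 := decreasing_eltD dx dx.
have m2 : submaj I (j (x + x)) (j x).
  by apply/submaj_cumul => s s0; rewrite [leRHS]xoo// leey.
(* If $2x$ and $x$ have the same rearrangement then $x=0$, whose integral is not infinite; otherwise
   strictness gives $2\|x\|<\|x\|$. *)
have [e|ne] := pselect (eq_L0 I (rearr I (j (x + x))) (rearr I (j x))).
  have x0 : x = 0.
    by apply: (addrI x); rewrite addr0; exact: decreasing_elt_inj e.
  by move: (xoo 1 ltr01); rewrite x0 cumul0.
have /decreasing_coneP c2 := d2; have /decreasing_coneP c1 := dx.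
have := hSKM c2 c1 m2 ne; rewrite -mulr2n normrMn mulr2n.
by rewrite gtrDl ltNge normr_ge0.
Qed.

(** The layer cake bound transfers integrability from $w^*$ to $|w|$. It is needed for dominating
    elements, which need not be decreasing. *)
Lemma integral_abs_lty w t : (\int[mu]_(s in A t) `|j w s| < +oo)%E.
Proof.
apply: integral_lty_of_rearr => //.
have [u [uw _]] := exists_rearr w.
have dux := rearr_of_eq uw.
by rewrite -dux; apply: cumul_lty; rewrite /decreasing_elt dux.
Qed.

End StrictlyMonotone.

End SymmetricSpace.

(** * Norm limits of decreasing elements *)

Section Limits.
Context {R : realType} (alpha : \bar R).
Hypothesis alpha_ge0 : (0 <= alpha)%E.
Local Notation mu := (@lebesgue_measure R).
Local Notation I := (base_interval alpha).
Local Notation A := (initial_segment alpha).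
Context {E : completeNormedModType R} (j : E -> R -> \bar R).
Hypothesis hE : symmetric_space I j.
Hypothesis hF : fatou_property I j.
Implicit Types (x y p : E) (w : nat -> E) (t : R).

Let hB := symmetric_bfs hE.

Let mj x : measurable_fun I (j x). Proof. exact: bfs_measurable hB x. Qed.

Lemma summable_terms_cvg0 (u : nat -> \bar R) : (forall n, (0 <= u n)%E) ->
  (\sum_(n <oo) u n < +oo)%E -> (u n @[n --> \oo] --> 0)%E.
Proof.
move=> u0 uoo; have := nneseries_tail_cvg uoo (fun n _ => u0 n).
apply: squeeze_cvge (cvg_cst _).
apply: nearW => n; rewrite u0 /=.
apply: le_trans (nneseries_lim_ge n.+1 (fun n _ _ => u0 n)).
by rewrite big_nat1.
Qed.

(** The partial sums of $\sum_n|w_n-p|$ have norms at most 2, so by the Fatou property the sum is an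
    element of $E$. It is thus finite a.e., which forces $w_n\to p$ a.e., and adding $|p|$ to it
    dominates every $|w_n|$. *)
Lemma exists_dominating w p : (forall n, `|w n - p| <= 2^-1 ^+ n) ->
  exists W, ae_on I (fun t => (forall n, `|j (w n) t| <= j W t)%E /\
    (j (w n) t @[n --> \oo] --> j p t)).
Proof.
move=> wp.
have [a aP] : exists a : nat -> E, forall n,
    eq_L0 I (j (a n)) (fun t => `|j (w n - p)%R t|%E) /\ `|a n| <= `|w n - p|.
  by have /choice[a aP] := fun n => exists_abs hE (w n - p); exists a.
pose g n t := `|j (w n - p)%R t|%E.
have g0 n t : (0 <= g n t)%E by exact: abse_ge0.
pose S n := \sum_(0 <= i < n) a i.
pose f t := (\sum_(i <oo) g i t)%E.
have jS : ae_on I (fun t => forall n, j (S n) t = (\sum_(0 <= i < n) g i t)%E).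
  apply: ae_on_foralln; elim=> [|n ih].
    by apply: ae_onS (eq_L0_0 hE) => t _; rewrite /S !big_nil.
  have := ae_onI ih (ae_onI (bfs_add hB (S n) (a n)) (aP n).1).
  apply: ae_onS => t _ [jS [jSa ja]].
  by rewrite /S !big_nat_recr//= -/(S n) jSa jS ja.
have mf : measurable_fun I f.
  apply: ge0_emeasurable_sum => // n _; exact: measurableT_comp.
(* The bound is the sum of the first [n] powers of $1/2$, starting from $2^0$. *)
have normS n : `|S n| <= 2 - 2 * 2^-1 ^+ n.
  elim: n => [|n ih]; first by rewrite /S big_nil normr0 expr0; lra.
  rewrite /S big_nat_recr//= -/(S n) exprS.
  have := ler_normD (S n) (a n); have := (aP n).2; have := wp n.
  move: ih; set h := _ ^+ n => *; lra.
have [z [zf _ _]] : exists z, [/\ eq_L0 I (j z) f,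
    nondecreasing_seq (fun n => `|S n|) & `|S n| @[n --> \oo] --> `|z|].
  apply: hF => //.
  - by move=> n; apply: ae_onS jS => t _ ->; exact: sume_ge0.
  - exists 2 => _ [n _ <-]; apply: le_trans (normS n) _.
    by rewrite gerBl mulr_ge0// exprn_ge0// invr_ge0.
  - apply: ae_onS jS => t _ jS; split.
      by move=> m n mn; rewrite !jS; exact: lee_sum_nneg_natr.
    under eq_fun do rewrite jS.
    by apply: is_cvg_nneseries => n _ _.
have [b [bp _]] := exists_abs hE p.
exists (z + b).
have wE n : ae_on I (fun t => j (w n) t = (j (w n - p)%R t + j p t)%E).
  by have := bfs_add hB (w n - p) p; rewrite subrK.
have H := ae_onI (ae_onI zf bp) (ae_onI (bfs_add hB z b)
  (ae_onI (ae_on_foralln wE) (ae_onI (bfs_finite hB z) (bfs_finite hB p)))).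
apply: ae_onS H => t _ [[jz jb] [-> [jw [zfin pfin]]]].
have gf n : (g n t <= f t)%E.
  apply: le_trans (nneseries_lim_ge n.+1 (fun i _ _ => g0 i t)).
  by rewrite big_nat_recr//= leeDr// sume_ge0.
split=> [n|].
  rewrite jw jz jb; apply: le_trans (lee_abs_add _ _) _.
  by apply: leeD2r; exact: gf.
under eq_fun do rewrite jw.
suff : (j (w n - p)%R t + j p t)%E @[n --> \oo] --> (0 + j p t)%E.
  by rewrite add0e.
apply: cvgeD.
- by rewrite fin_num_adde_defl.
(* Finiteness of [j z t] makes the series of the $|w_n-p|$ converge at [t], so its terms tend to
   0. *)
- apply/cvg_abse0P; apply: summable_terms_cvg0 => //.
  by rewrite -/(f t) -jz -ge0_fin_numE// jz nneseries_ge0.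
- exact: cvg_cst.
Qed.

Hypothesis hSKM : strictly_K_monotone I j (decreasing_cone I j).

(** Signs and antitonicity survive the a.e. limit of [exists_dominating]. The dominating element is
    integrable on [A t] by [integral_abs_lty], so dominated convergence applies. *)
Lemma decreasing_elt_lim w p : (forall n, `|w n - p| <= 2^-1 ^+ n) ->
  (forall n, decreasing_elt alpha j (w n)) ->
  decreasing_elt alpha j p /\
  forall t, (cumul alpha j (w n) t @[n --> \oo] --> cumul alpha j p t)%E.
Proof.
move=> wp dw; have [W HW] := exists_dominating wp.
have dp : decreasing_elt alpha j p.
  apply: (decreasing_elt_ae hE (ae_onI HW (ae_on_foralln dw))).
    move=> s _ [[_ cv] dws].
    rewrite -(cvg_lim _ cv)//; apply: lime_ge; first by apply/cvg_ex; eexists; exact: cv.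
    by apply: nearW => n; rewrite dws rearr_ge0.
  move=> s t _ [[_ cs] ds] _ [[_ ct] dt] st.
  rewrite -(cvg_lim _ ct)// -(cvg_lim _ cs)//.
  apply: lee_lim; [exact: cvgP ct|exact: cvgP cs|].
  by apply: nearW => n; rewrite ds dt rearr_antitone.
split=> // t; rewrite cumulE//.
(* Dominated convergence concerns the functions themselves; decreasingness lets them replace their
   rearrangements. *)
have -> : (fun n => cumul alpha j (w n) t) =
    (fun n => \int[mu]_(s in A t) j (w n) s)%E.
  by apply/funext => n; rewrite cumulE.
have mA := measurable_initial_segment alpha t.
have F := ae_filter_ringOfSetsType mu.
have sub := ae_on_sub (@sub_initial_segment _ alpha t).
have [] // := @dominated_convergence _ _ _ mu (A t) mA (fun n => j (w n)) (j p)
  (fun s => `|j W s|%E).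
- by move=> n; exact: measurable_funSI.
- exact: measurable_funSI.
- by apply: sub; apply: ae_onS HW => s _ [].
- apply/integrableP; split.
    by apply: measurableT_comp => //; exact: measurable_funSI.
  under eq_integral do rewrite abse_id.
  exact: integral_abs_lty.
- have : ae_on (A t) (fun s => forall n, (`|j (w n) s| <= `|j W s|)%E).
    apply: sub; apply: ae_onS HW => s _ [wW _] n.
    by apply: le_trans (wW n) _; exact: lee_abs.
  by rewrite /ae_on; apply: filterS => s ws n As; exact: ws.
Qed.

End Limits.

(** * Extraction of subsequences *)

Section Sequences.
Context {R : realType}.

Lemma increasing_seq_ge (s : nat -> nat) n : increasing_seq s -> (n <= s n)%N.
Proof.
move=> /increasing_seqP inc; elim: n => [|n ih] //.
by apply: leq_ltn_trans ih _; have := inc n; rewrite ltEnat.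
Qed.

Lemma cvg_nat_pinfty (s : nat -> nat) : (forall n, (n <= s n)%N) ->
  s n @[n --> \oo] --> \oo.
Proof.
move=> sn; apply/cvgnyPge => N; exists N => // n /= Nn.
exact: leq_trans Nn (sn n).
Qed.

Lemma cvg_geometric_bound {V : normedModType R} (w : nat -> V) p :
  (forall n, `|w n - p| <= 2^-1 ^+ n) -> w n @[n --> \oo] --> p.
Proof.
move=> wp; apply/subr_cvg0; apply: norm_cvg0.
apply: (@squeeze_cvgr _ _ _ _ (fun=> 0) (fun n => 2^-1 ^+ n)).
- by apply: nearW => n; rewrite normr_ge0 wp.
- exact: cvg_cst.
- by apply: cvg_expr; rewrite ger0_norm ?invr_ge0// invf_lt1// ltr1n.
Qed.

(** The indices need not increase: $n\le s(n)$ already preserves limits at infinity, so one choice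
    for each $n$ suffices. *)
Lemma not_cvg0_subseq {V : normedModType R} (w : nat -> V) :
  ~ (w n @[n --> \oo] --> 0) ->
  exists e : R, exists s : nat -> nat, [/\ 0 < e, forall n, (n <= s n)%N &
    forall n, e <= `|w (s n)|].
Proof.
move=> nw; have [e e0 He] : exists2 e : R, 0 < e &
    forall N, exists n, (N <= n)%N /\ e <= `|w n|.
  apply: contrapT => H; apply: nw; apply/cvgr0Pnorm_lt => e e0.
  apply: contrapT => nH; apply: H; exists e => // N.
  apply: contrapT => nN; apply: nH; exists N => // n /= Nn.
  by rewrite ltNge; apply/negP => ewn; apply: nN; exists n.
by have /choice[s sP] := He; exists e, s; split => // n; have [] := sP n.
Qed.

(** A cluster point of the pairs in the compact product provides common indices for both sequences;
    an index past $m$ is chosen for each radius $2^{-m}$. This rate is the one required by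
    [exists_dominating]. *)
Lemma compact_pair_subseq {V : normedModType R} (K L : set V) (a b : nat -> V) :
  compact K -> compact L -> (forall n, K (a n)) -> (forall n, L (b n)) ->
  exists p q, exists s : nat -> nat, [/\ forall n, (n <= s n)%N,
    forall n, `|a (s n) - p| <= 2^-1 ^+ n &
    forall n, `|b (s n) - q| <= 2^-1 ^+ n].
Proof.
move=> cK cL Ka Lb.
have [] := compact_setX cK cL (F := (fun n => (a n, b n)) @ \oo).
  by exists 0%N => // n _ /=; split.
move=> [p q] [_ cpq]; exists p, q.
suff /choice[s sP] : forall m, exists n, [/\ (m <= n)%N,
    `|a n - p| <= 2^-1 ^+ m & `|b n - q| <= 2^-1 ^+ m].
  by exists s; split=> n; have [] := sP n.
move=> m; have e0 : 0 < 2^-1 ^+ m :> R by rewrite exprn_gt0// invr_gt0.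
have /(_ [set z | exists2 n, (m <= n)%N & z = (a n, b n)]
         (ball p (2^-1 ^+ m) `*` ball q (2^-1 ^+ m)))[] := cpq.
- by exists m => // n /= mn; exists n.
- by exists (ball p (2^-1 ^+ m), ball q (2^-1 ^+ m)) => //; split; exact: nbhsx_ballx.
move=> _ [[n mn ->]] [/= pa qb]; exists n; split => //.
- by rewrite distrC; apply/ltW; move: pa; rewrite -ball_normE.
- by rewrite distrC; apply/ltW; move: qb; rewrite -ball_normE.
Qed.

End Sequences.

(** * Compactness of a sequence from rotundity *)

Section Rotundity.
Context {R : realType} (E : completeNormedModType R) (k : nat) (C : set E).
Hypothesis hrot : compactly_fully_rotund k C.
Hypothesis CZ : forall (a : R) x, 0 <= a -> C x -> C (a *: x).

(** Rotundity applies to $z_n=w_n/\|w_n\|$: since $\|w_n\|\to l$, replacing $z_n$ by $w_n/l$ costs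
    an error tending to 0, and the hypothesis on sums bounds below the norm of the modified $k$-fold
    sums by $k$. *)
Lemma rotund_compact (w : nat -> E) (l : R) : 0 < l -> (forall n, C (w n)) ->
  (forall n, l <= `|w n|) -> `|w n| @[n --> \oo] --> l ->
  (forall f : 'I_k -> nat, k%:R * l <= `|\sum_(i < k) w (f i)|) ->
  exists2 K, compact K & forall n, K (w n).
Proof.
move=> l0 Cw lw wl sumw.
have w0 n : 0 < `|w n| by apply: lt_le_trans (lw n).
pose z n := `|w n|^-1 *: w n.
have z1 n : `|z n| = 1.
  by rewrite normrZ normfV normr_id mulVf// gt_eqF.
(* Both vectors are multiples of $w_n$, and $l\le\|w_n\|$ fixes the sign of the difference of the
   coefficients. *)
have zw n : `|l^-1 *: w n - z n| = l^-1 * `|w n| - 1.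
  rewrite -scalerBl normrZ ger0_norm; first by rewrite mulrBl mulVf// gt_eqF.
  by rewrite subr_ge0 lef_pV2// posrE.
have pz : precompact (range z).
  apply: hrot => [n|phi phi_inc].
    by split; [apply: CZ; rewrite // invr_ge0 normr_ge0|exact: z1].
  (* [d n] bounds the total error over the [k] subsequences, so the norm of the sum of the $z$ lies
     between $k-d_n$ and $k$. *)
  pose d n := \sum_(i < k) (l^-1 * `|w (phi i n)| - 1).
  have d0 : d n @[n --> \oo] --> 0.
    rewrite [X in _ --> X](_ : 0 = \sum_(i < k) (l^-1 * l - 1)).
      apply: cvg_big => [|i _]; first exact: add_continuous.
      apply: cvgB; last exact: cvg_cst.
      apply: cvgMr.
      have phiy : phi i n @[n --> \oo] --> \oo.
        by apply: cvg_nat_pinfty => n; exact: increasing_seq_ge.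
      exact: cvg_comp phiy wl.
    by rewrite big1// => i _; rewrite mulVf ?subrr// gt_eqF.
  apply: (@squeeze_cvgr _ _ _ _ (fun n => k%:R - d n) (fun=> k%:R)).
  - apply: nearW => n; apply/andP; split; last first.
      apply: le_trans (ler_norm_sum _ _ _) _.
      by rewrite (eq_bigr (fun=> 1))// sumr_const card_ord.
    rewrite lerBlDr.
    apply: (@le_trans _ _ `|\sum_(i < k) l^-1 *: w (phi i n)|).
      rewrite -scaler_sumr normrZ ger0_norm ?invr_ge0 ?(ltW l0)//.
      by rewrite ler_pdivlMl// mulrC sumw.
    rewrite -lerBlDl; apply: le_trans (lerB_dist _ _) _.
    rewrite -sumrB; apply: le_trans (ler_norm_sum _ _ _) _.
    by apply: ler_sum => i _; rewrite zw.
  - by rewrite -[X in _ --> X]subr0; apply: cvgB => //; exact: cvg_cst.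
  - exact: cvg_cst.
have [B wB] : exists B, forall n, `|w n| <= B.
  have /bounded_fun_has_ubound[B wB] := cvg_seq_bounded (cvgP _ wl).
  by exists B => n; apply: wB; exists n.
(* Normalization is undone by scalar multiplication, continuous on the compact product of $[l,B]$
   with the closure of the range of $z$. *)
exists ((fun c : R^o * E => c.1 *: c.2) @` (`[l, B]%classic `*` closure (range z))).
  apply: continuous_compact.
    by apply: continuous_subspaceT => c; exact: scale_continuous.
  apply: compact_setX; first exact: segment_compact.
  by rewrite -precompactE.
move=> n; exists (`|w n|, z n) => /=.
  split => /=; first by rewrite in_itv /= lw wB.
  by apply: subset_closure; exists n.
by rewrite scalerA divff ?scale1r// gt_eqF.
Qed.

End Rotundity.

(** * Comparison of two sequences of decreasing elements *)

Section Conclusion.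
Context {R : realType} (alpha : \bar R).
Hypothesis alpha_ge0 : (0 <= alpha)%E.
Local Notation I := (base_interval alpha).
Context {E : completeNormedModType R} (j : E -> R -> \bar R) (k : nat).
Hypothesis hE : symmetric_space I j.
Hypothesis hF : fatou_property I j.
Hypothesis hrot : compactly_fully_rotund k (decreasing_cone I j).
Hypothesis hSKM : strictly_K_monotone I j (decreasing_cone I j).

(* Each w m with m <= M majorizes u M, and the x^** are additive on decreasing
   elements; hence a sum of k terms of w majorizes k (u M). *)
Lemma norm_sum_ge (u w : nat -> E) (l : R) (f : 'I_k -> nat) :
  (forall n, decreasing_elt alpha j (u n)) ->
  (forall n, decreasing_elt alpha j (w n)) ->
  (forall n, submaj I (j (u n.+1)) (j (u n))) ->
  (forall n, submaj I (j (u n)) (j (w n))) ->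
  (forall n, l <= `|u n|) -> k%:R * l <= `|\sum_(i < k) w (f i)|.
Proof.
move=> du dw uu uw lu.
pose M := \max_(i < k) f i.
have cuu t m n : 0 < t -> (m <= n)%N ->
    (cumul alpha j (u n) t <= cumul alpha j (u m) t)%E.
  move=> t0; elim: n => [|n ih]; first by rewrite leqn0 => /eqP ->.
  rewrite leq_eqVlt => /predU1P[->//|]; rewrite ltnS => /ih; apply: le_trans.
  by move: (uu n) => /(submaj_cumul alpha_ge0 hE); apply.
have H t : 0 < t -> [/\ decreasing_elt alpha j (\sum_(i < k) u M),
    decreasing_elt alpha j (\sum_(i < k) w (f i)) &
    (cumul alpha j (\sum_(i < k) u M)%R t <=
     cumul alpha j (\sum_(i < k) w (f i))%R t)%E].
  move=> t0; apply: (le_cumul_sum hE) => [i|i|i]; [exact: du|exact: dw|].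
  apply: (@le_trans _ _ (cumul alpha j (u (f i)) t)); first exact/cuu/leq_bigmax.
  by move: (uw (f i)) => /(submaj_cumul alpha_ge0 hE); apply.
(* Decreasingness of the sums does not involve $t$, so any positive value extracts it. *)
have [dsu dsw _] := H 1 ltr01.
apply: le_trans (submaj_norm_le alpha_ge0 hE hSKM dsu dsw _).
  by rewrite sumr_const card_ord normrMn -[leRHS]mulr_natl ler_wpM2l.
by apply/(submaj_cumul alpha_ge0 hE) => t t0; have [] := H t t0.
Qed.

(** Majorization depends only on rearrangements, and $x^*$ has the norm of $x$, so the theorem
    reduces to this case. *)
Lemma decreasing_sequences_cvg (u v : nat -> E) (l : R) :
  (forall n, decreasing_elt alpha j (u n)) ->
  (forall n, decreasing_elt alpha j (v n)) ->
  (forall n, submaj I (j (u n.+1)) (j (u n))) ->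
  (forall n, submaj I (j (u n)) (j (v n))) ->
  `|u n| @[n --> \oo] --> l -> `|v n| @[n --> \oo] --> l ->
  `|u n - v n| @[n --> \oo] --> (0 : R).
Proof.
move=> du dv uu uv ul vl.
have u_anti : nonincreasing_seq (fun n => `|u n|).
  by apply/nonincreasing_seqP => n; exact: (submaj_norm_le alpha_ge0 hE hSKM).
have lu n : l <= `|u n|.
  by rewrite -(cvg_lim _ ul)//; apply: nonincreasing_cvgn_ge => //; exact: cvgP ul.
have lv n : l <= `|v n|.
  by apply: le_trans (lu n) _; exact: (submaj_norm_le alpha_ge0 hE hSKM).
have : 0 <= l.
  rewrite -(cvg_lim _ ul)//; apply: limr_ge; first exact: cvgP ul.
  by apply: nearW.
rewrite le_eqVlt => /predU1P[l0|l0].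
  rewrite -l0 in ul vl.
  apply: (@squeeze_cvgr _ _ _ _ (fun=> 0) (fun n => `|u n| + `|v n|)).
  - by apply: nearW => n; rewrite normr_ge0 ler_normB.
  - exact: cvg_cst.
  - by rewrite -[X in _ --> X]addr0; exact: cvgD.
have Z (a : R) x : 0 <= a -> decreasing_cone I j x -> decreasing_cone I j (a *: x).
  move=> a0 /(decreasing_coneP alpha_ge0 hE) dx.
  by apply/(decreasing_coneP alpha_ge0 hE); exact: decreasing_eltZ.
have cone x : decreasing_elt alpha j x -> decreasing_cone I j x.
  by move=> dx; exact/(decreasing_coneP alpha_ge0 hE).
have [K cK Ku] : exists2 K, compact K & forall n, K (u n).
  apply: (rotund_compact hrot Z l0 _ lu ul) => [n|f]; first exact: cone.
  (* Here [u] serves as its own majorant, by reflexivity of majorization. *)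
  exact: (norm_sum_ge f du du uu (fun n t _ => lexx _) lu).
have [L cL Lv] : exists2 L, compact L & forall n, L (v n).
  apply: (rotund_compact hrot Z l0 _ lv vl) => [n|f]; first exact: cone.
  exact: (norm_sum_ge f du dv uu uv lu).
apply: contrapT => nuv.
have [|e [s [e0 sn es]]] := @not_cvg0_subseq _ _ (fun n => u n - v n).
  by move=> uv0; apply: nuv; exact/norm_cvg0P.
have [p [q [r [rn up vq]]]] := compact_pair_subseq cK cL
  (a := u \o s) (b := v \o s) (fun n => Ku (s n)) (fun n => Lv (s n)).
have srn n : (n <= s (r n))%N by apply: leq_trans (rn n) (sn _).
have [dp cp] := decreasing_elt_lim alpha_ge0 hE hF hSKM up (fun n => du _).
have [dq cq] := decreasing_elt_lim alpha_ge0 hE hF hSKM vq (fun n => dv _).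
have sub_lim (a : nat -> E) : `|a n| @[n --> \oo] --> l ->
    `|a (s (r n))| @[n --> \oo] --> l.
  by move=> al; apply: cvg_comp al; exact: cvg_nat_pinfty.
have norm_p : `|p| = l.
  apply: (cvg_unique _ _ (sub_lim _ ul)) => //.
  by apply: cvg_norm; exact: cvg_geometric_bound up.
have norm_q : `|q| = l.
  apply: (cvg_unique _ _ (sub_lim _ vl)) => //.
  by apply: cvg_norm; exact: cvg_geometric_bound vq.
have pq : submaj I (j p) (j q).
  apply/(submaj_cumul alpha_ge0 hE) => t t0.
  rewrite -(cvg_lim (@ereal_hausdorff R) (cp t)).
  rewrite -(cvg_lim (@ereal_hausdorff R) (cq t)).
  apply: lee_lim; [exact: cvgP (cp t)|exact: cvgP (cq t)|].
  apply: nearW => n.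
  exact: ((submaj_cumul alpha_ge0 hE _ _).1 (uv (s (r n))) t t0).
(* Both norms equal [l], so strictness is impossible and the rearrangements must agree. *)
have eqpq : p = q.
  apply: contrapT => npq.
  have := hSKM (cone _ dp) (cone _ dq) pq.
  rewrite norm_p norm_q ltxx => H; apply/notF/H => e_pq.
  by apply: npq; exact: decreasing_elt_inj e_pq.
(* With a common limit, the differences along [s (r n)] tend to 0, although each has norm at least
   [e]. *)
have : `|u (s (r n)) - v (s (r n))| @[n --> \oo] --> 0.
  rewrite -[X in _ --> X](normr0 E) -[X in `|X|](subrr p).
  apply: cvg_norm; apply: cvgB; first exact: cvg_geometric_bound up.
  by rewrite eqpq; exact: cvg_geometric_bound vq.
move=> /cvgr_lt /(_ e e0) [N _ /(_ N (leqnn N))] /=.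
by rewrite ltNge es.
Qed.

End Conclusion.

Unset Implicit Arguments.
Set Strict Implicit.

Theorem theorem5p7 (R : realType) (alpha : \bar R)
    (halpha : alpha = 1%E \/ alpha = +oo%E)
    (E : completeNormedModType R) (j : E -> R -> \bar R)
    (k : nat) (hk : (2 <= k)%N)
    (hE : symmetric_space (base_interval alpha) j)
    (hF : fatou_property (base_interval alpha) j)
    (hrot : compactly_fully_rotund k (decreasing_cone (base_interval alpha) j))
    (hSKM : strictly_K_monotone (base_interval alpha) j
              (decreasing_cone (base_interval alpha) j)) :
  decreasing_uniformly_K_monotone (base_interval alpha) j.
Proof.
have a0 : (0 <= alpha)%E by case: halpha => ->.
move=> x y xy [l [xl yl]].
(* Symmetry of the space represents each $x_n^*$ by an element of the same norm, so the norm limits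
   carry over. *)
have /choice[u uP] := fun n => exists_rearr a0 hE (x n).
have /choice[v vP] := fun n => exists_rearr a0 hE (y n).
have ru n := rearr_of_eq a0 hE (uP n).1.
have rv n := rearr_of_eq a0 hE (vP n).1.
exists u, v; split=> [n|n|]; [exact: (uP n).1|exact: (vP n).1|].
apply: (decreasing_sequences_cvg a0 hE hF hrot hSKM (l := l)) => [n|n|n|n||].
- by rewrite /decreasing_elt ru; exact: (uP n).1.
- by rewrite /decreasing_elt rv; exact: (vP n).1.
- exact: (eq_submaj (esym (ru _)) (esym (ru _)) (xy n).1).
- exact: (eq_submaj (esym (ru _)) (esym (rv _)) (xy n).2).
- by under eq_fun do rewrite (uP _).2.
- by under eq_fun do rewrite (vP _).2.
Qed.
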